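(* Let $n\ge3$ be an integer, let $a=(a_1,\ldots,a_{n+1})\in\mathbb{R}^{n+1}$, and let $\varphi:\mathcal{S}^\circ(a)\to\mathcal{M}^\circ(a)$ be the bijection between the big opens whose restriction to each $\mathcal{S}_{kj}^{(i_0)}(a)$ is $\varphi_{kj}^{(i_0)}$. Let $x\in\mathcal{S}^\circ(a)$. Then the monodromy $\varphi(x)$ is unitary if and only if $x\in\mathcal{S}^\circ(a)\cap\mathbb{R}^m$. If this is the case, the signature of $\varphi(x)$ is determined as follows. - If $x\in\mathcal{S}_{kj}^{(0)}(a)\cap\mathbb{R}^m$ for some $(j,k)\in\mathcal{I}_n$, then the signature is $(1,1)$ if and only if either $x_{kj}^2-4>0$, or $x_{kj}^2-4<0$ and $\psi(x_{kj},a_k,a_j)>0$; and the signature is $(2,0)$ or $(0,2)$ if and only if $x_{kj}^2-4<0$ and $\psi(x_{kj},a_k,a_j)<0$. - If $x\in\mathcal{S}_{kj}^{(i_0)}(a)\cap\mathbb{R}^m$ for some $(j,k)\in\mathcal{I}_n$ and $i_0\in\{1,2,\ldots,n\}\setminus\{j,k\}$, then the signature is $(1,1)$ if and only if either $x_{kj}^2-4>0$, or $x_{kj}^2-4<0$ and $\psi(x_{kji_0},x_{kj},a_{i_0})>0$; and the signature is $(2,0)$ or $(0,2)$ if and only if $x_{kj}^2-4<0$ and $\psi(x_{kji_0},x_{kj},a_{i_0})<0$. The signature of the monodromy $\varphi(x)$ does not depend on the choice of the chart $\mathcal{S}_{kj}^{(i_0)}(a)$ to which $x$ belongs.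
   Context: **Unitarity.** For non-negative integers $p,q$ with $p+q=2$ let $I_{p,q}=I_p\oplus(-I_q)$ and $\mathrm{SU}(p,q)=\{U\in\mathrm{SL}(2,\mathbb{C}):\bar U^TI_{p,q}U=I_{p,q}\}$ (so $\mathrm{SU}(2,0)=\mathrm{SU}(0,2)=\mathrm{SU}(2)$). A class $[\rho]\in\mathcal{M}(a)^{irr}$ (defined below; called a monodromy) is unitary of signature $(p,q)$ if some representative $(M_1,\dots,M_n)$ of it satisfies $\langle M_1,\dots,M_n\rangle\subset\mathrm{SU}(p,q)$; it is unitary if this holds for some $(p,q)$. **Moduli space.** Fix $n\ge3$ and $a=(a_1,\dots,a_{n+1})\in\mathbb{C}^{n+1}$ (the condition $a_j\neq\pm2$ is not required). $\mathcal{O}(a_j)=\{M\in \mathrm{SL}(2,\mathbb{C}): \operatorname{tr}M=a_j\}$. For $M_1,\dots,M_n\in\mathrm{SL}(2,\mathbb{C})$ put $M_{n+1}:=(M_nM_{n-1}\cdots M_1)^{-1}$. $\mathcal{M}(a)$ is the set of tuples $(M_1,\dots,M_n)\in\mathcal{O}(a_1)\times\cdots\times\mathcal{O}(a_n)$ with $M_{n+1}\in\mathcal{O}(a_{n+1})$, modulo simultaneous conjugation by $\mathrm{SL}(2,\mathbb{C})$; $[\rho]=[(M_1,\dots,M_n)]$ denotes a class. $\mathcal{M}(a)^{irr}\subset\mathcal{M}(a)$ is the subset of irreducible classes (no common invariant subspace of $M_1,\dots,M_n$ other than $\{0\}$ and $\mathbb{C}^2$). **Trace coordinates.** For $[\rho]\in\mathcal{M}(a)^{irr}$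 put $x_{ji}=\operatorname{tr}(M_jM_i)$, $x_{kji}=\operatorname{tr}(M_kM_jM_i)$ for distinct $i,j,k\in\{1,\dots,n\}$. Coordinates on $\mathbb{C}^m$: if $n=3$, $m=3$ and $x=(x_{21},x_{31},x_{32})$, with $x_{321}:=a_4$; if $n\ge4$, $m=\binom n3+\binom n2$ and $x$ consists of all $x_{ji}$ ($1\le i<j\le n$) and all $x_{kji}$ ($1\le i<j<k\le n$). For any $x\in\mathbb{C}^m$ the symbols with indices in other orders are defined by $x_{ij}=x_{ji}$, $x_{kji}=x_{jik}=x_{ikj}$ and $x_{kij}=a_kx_{ji}+a_jx_{ki}+a_ix_{kj}-a_ka_ja_i-x_{kji}$ (identities satisfied by the traces). **The affine algebraic set $\mathcal{S}(a)\subset\mathbb{C}^m$** is the common zero set of the following polynomials. Put $s_3(i_1,i_2,i_3)=a_{i_1}x_{i_3i_2}+a_{i_2}x_{i_3i_1}+a_{i_3}x_{i_2i_1}-a_{i_3}a_{i_2}a_{i_1}-2x_{i_3i_2i_1}$ for $i_1<i_2<i_3$, $z_{i,i}=\frac12a_i^2-2$, and $z_{i,j}=x_{ij}-\frac12a_ia_j$ for $i\ne j$. - Type 1 ($n\ge3$): $s_3(i_1,i_2,i_3)s_3(j_1,j_2,j_3)+2\det(z_{i_p,j_q})_{1\le p,q\le3}$ for all $1\le i_1<i_2<i_3\le n$, $1\le j_1<j_2<j_3\le n$. - Type 2 ($n\ge4$): $\sum_{k=0}^3(-1)^kz_{i,p_k}\,s_3(p_0,\dots,\widehat{p_k},\dots,p_3)$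 for all $1\le i\le n$, $1\le p_0<p_1<p_2<p_3\le n$ (hat means omission). - Type 3 ($n\ge4$): $g_{n,n-1,\dots,1}(x)-a_{n+1}$, where $g_{i_1}=a_{i_1}$, $g_{i_2,i_1}=x_{i_2i_1}$, $g_{i_3,i_2,i_1}=x_{i_3i_2i_1}$ for increasing $i_1<i_2<\cdots$, and for $k\ge4$, $i_1<\cdots<i_k$, $$\begin{aligned}g_{i_k,\dots,i_1}=\tfrac12\{&g_{i_k,\dots,i_4}a_{i_3}a_{i_2}a_{i_1}+g_{i_k,\dots,i_4}x_{i_3i_2i_1}+\textstyle\sum_{p=1}^3a_{i_p}g_{i_k,\dots,\widehat{i_p},\dots,i_1}\\&+g_{i_k,\dots,i_3}x_{i_2i_1}-g_{i_k,\dots,i_4,i_2}x_{i_3i_1}+g_{i_k,\dots,i_4,i_1}x_{i_3i_2}\\&-g_{i_k,\dots,i_4}a_{i_3}x_{i_2i_1}-g_{i_k,\dots,i_4}a_{i_1}x_{i_3i_2}-g_{i_k,\dots,i_4,i_1}a_{i_3}a_{i_2}-g_{i_k,\dots,i_3}a_{i_2}a_{i_1}\}.\end{aligned}$$ Assigning to $[\rho]$ its trace coordinates gives a map $\Phi:\mathcal{M}(a)^{irr}\to\mathcal{S}(a)$. **Charts.** $\mathcal{I}_n$ is the set of $(j,k)\in\mathbb{N}^2$ with $1\le j\le n$ and: $2\le k<n$ if $j=1$; $j<k\le n$ if $2\le j<n$; $k=1$ if $j=n$. Let $\psi(s,t,u)=s^2+t^2+u^2-stu-4$. For $(j,k)\in\mathcal{I}_n$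 put $p_{kj}^{(0)}(x)=(x_{kj}^2-4)\psi(x_{kj},a_k,a_j)$ and, for $i_0\in\{1,\dots,n\}\setminus\{j,k\}$, $p_{kj}^{(i_0)}(x)=(x_{kj}^2-4)\psi(x_{kji_0},x_{kj},a_{i_0})$. Set $\mathcal{S}_{kj}^{(i_0)}(a)=\{x\in\mathcal{S}(a):p_{kj}^{(i_0)}(x)\ne0\}$, $\mathcal{M}_{kj}^{(i_0)}(a)=\{[\rho]\in\mathcal{M}(a)^{irr}:p_{kj}^{(i_0)}(\Phi([\rho]))\neq0\}$. The big opens are $\mathcal{S}^\circ(a)=\bigcup\mathcal{S}_{kj}^{(i_0)}(a)$ and $\mathcal{M}^\circ(a)=\bigcup\mathcal{M}_{kj}^{(i_0)}(a)$, unions over $(j,k)\in\mathcal{I}_n$ and $i_0\in\{0,\dots,n\}\setminus\{j,k\}$. **Normal forms and $\varphi$.** For $x\in\mathcal{S}_{kj}^{(i_0)}(a)$ fix a square root $r_{kj}=\sqrt{x_{kj}^2-4}$ and put $\lambda_{kj}^\pm=(x_{kj}\pm r_{kj})/2$. The $(k,j;i_0)$-normal form of $x$ is the following tuple $(M_1,\dots,M_n)$, with $M_s=\begin{pmatrix} u_{11}^{(s)} & u_{12}^{(s)} \\ u_{21}^{(s)} & u_{22}^{(s)} \end{pmatrix}$. In all cases $$u_{11}^{(j)}=-\tfrac{a_k-\lambda_{kj}^+a_j}{r_{kj}},\ u_{22}^{(j)}=\tfrac{a_k-\lambda_{kj}^-a_j}{r_{kj}},\ u_{11}^{(k)}=-\tfrac{a_j-\lambda_{kj}^+a_k}{r_{kj}},\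 u_{22}^{(k)}=\tfrac{a_j-\lambda_{kj}^-a_k}{r_{kj}},$$ $$u_{12}^{(k)}=-\lambda_{kj}^+u_{12}^{(j)},\quad u_{21}^{(k)}=-\lambda_{kj}^-u_{21}^{(j)},\quad u_{11}^{(i)}=\tfrac{x_{kji}-\lambda_{kj}^-a_i}{r_{kj}},\ u_{22}^{(i)}=-\tfrac{x_{kji}-\lambda_{kj}^+a_i}{r_{kj}}\ (i\ne j,k).$$ (i) If $i_0=0$: $u_{21}^{(j)}=1$, $u_{12}^{(j)}=-\psi(x_{kj},a_k,a_j)/r_{kj}^2$, and for $i\neq j,k$ $$u_{12}^{(i)}=\tfrac{x_{ki}-a_ku_{22}^{(i)}+\lambda_{kj}^+(x_{ji}-a_ju_{11}^{(i)})}{r_{kj}},\quad u_{21}^{(i)}=\tfrac{r_{kj}\{x_{ki}-a_ku_{11}^{(i)}+\lambda_{kj}^-(x_{ji}-a_ju_{22}^{(i)})\}}{\psi(x_{kj},a_k,a_j)}.$$ (ii) If $i_0\in\{1,\dots,n\}\setminus\{j,k\}$, write $\psi_0=\psi(x_{kji_0},x_{kj},a_{i_0})$: $u_{21}^{(i_0)}=1$, $u_{12}^{(i_0)}=-\psi_0/r_{kj}^2$, $$u_{12}^{(j)}=-\tfrac{x_{ki_0}-a_ku_{11}^{(i_0)}+\lambda_{kj}^-(x_{ji_0}-a_ju_{22}^{(i_0)})}{r_{kj}},\quad u_{21}^{(j)}=-\tfrac{r_{kj}\{x_{ki_0}-a_ku_{22}^{(i_0)}+\lambda_{kj}^+(x_{ji_0}-a_ju_{11}^{(i_0)})\}}{\psi_0},$$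 and for $i\ne j,k,i_0$ $$u_{12}^{(i)}=-\tfrac{\lambda_{kj}^-x_{ii_0}+r_{kj}u_{11}^{(i)}u_{11}^{(i_0)}-x_{kjii_0}}{r_{kj}},\quad u_{21}^{(i)}=-\tfrac{r_{kj}(\lambda_{kj}^+x_{ii_0}-r_{kj}u_{22}^{(i)}u_{22}^{(i_0)}-x_{kjii_0})}{\psi_0},$$ where $x_{kjii_0}=\frac12(a_ka_ja_ia_{i_0}+a_kx_{jii_0}+a_jx_{kii_0}+a_ix_{kji_0}+a_{i_0}x_{kji}+x_{kj}x_{ii_0}-x_{ki}x_{ji_0}+x_{ki_0}x_{ji}-a_ka_jx_{ii_0}-a_ka_{i_0}x_{ji}-a_ja_ix_{ki_0}-a_{i_0}a_ix_{kj})$. The map $\varphi_{kj}^{(i_0)}:\mathcal{S}_{kj}^{(i_0)}(a)\to\mathcal{M}_{kj}^{(i_0)}(a)$ sends $x$ to the class $[(M_1,\dots,M_n)]$ of its normal form; this class does not depend on the choice of square root. The maps $\varphi_{kj}^{(i_0)}$ are bijections, agree on overlaps, and glue to a bijection $\varphi:\mathcal{S}^\circ(a)\to\mathcal{M}^\circ(a)$, which is inverse to the restriction of $\Phi$ to $\mathcal{M}^\circ(a)$. *)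

(* Defs.v *)
From HB Require Import structures.
From mathcomp Require Import all_boot all_order all_algebra.
From mathcomp Require Import boolp classical_sets functions reals.
From mathcomp Require Export complex.

Set Implicit Arguments.
Unset Strict Implicit.
Unset Printing Implicit Defensive.

Import Order.TTheory GRing.Theory Num.Theory.
Local Open Scope ring_scope.

(* The complex numbers are R[i] for R : realType; the definitions are over    *)
(* an arbitrary numClosedFieldType C.                                         *)
(* The indices 1, ..., n are the elements of 'I_n, shifted by one; the        *)
(* parameter a_(n+1) is a ord_max.                                            *)

(* Coordinates of C^m.  An unordered pair {i < j} indexes x_ji and, when      *)
(* n >= 4, an unordered triple {i < j < k} indexes x_kji.                     *)
Definition is_coord (n : nat) (A : {set 'I_n}) : bool :=
  (#|A| == 2) || ((3 < n)%N && (#|A| == 3)).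

Definition coord (n : nat) := {A : {set 'I_n} | is_coord A}.

Lemma card_coord (n : nat) : (3 <= n)%N ->
  #|{: coord n}| = if n == 3 then 3 else ('C(n, 3) + 'C(n, 2))%N.
Proof.
move=> n3; rewrite card_sig.
have card_k k : #|[set A : {set 'I_n} | #|A| == k]%SET| = 'C(n, k).
  by rewrite card_draws card_ord.
have [n_eq3|n_neq3] := eqVneq n 3.
  transitivity #|[set A : {set 'I_n} | #|A| == 2]%SET|; last first.
    by rewrite card_k n_eq3.
  have n_le3 : (3 < n)%N = false by rewrite n_eq3.
  by apply: eq_card => A; rewrite !inE /is_coord n_le3 orbF.
have n_gt3 : (3 < n)%N by rewrite ltn_neqAle eq_sym n_neq3.
rewrite -!card_k addnC -cardsUI.
rewrite [X in (_ + X)%N](_ : _ = 0%N) ?addn0; last first.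
  apply/eqP; rewrite cards_eq0; apply/eqP/setP => A; rewrite !inE.
  by case: eqP => // ->.
by apply: eq_card => A; rewrite !inE /is_coord n_gt3.
Qed.

Definition cpoint (C : Type) (n : nat) := coord n -> C.

Definition real_point (C : numClosedFieldType) (n : nat) (x : cpoint C n) : Prop :=
  forall A : coord n, x A \is Num.real.

(* Tuples (M_1, ..., M_n) of 2 x 2 matrices. *)
Definition mtuple (C : Type) (n : nat) := 'I_n -> 'M[C]_2.

Section Coordinates.
Variables (C : numClosedFieldType) (n : nat).
Variables (a : 'I_n.+1 -> C) (x : cpoint C n).

Definition par (i : 'I_n) : C := a (widen_ord (leqnSn n) i).

Definition xval (A : {set 'I_n}) : C := oapp x 0 (insub A).

Definition x2 (j i : 'I_n) : C := xval [set i; j]%SET.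

(* x_kji for any order of the indices.  The first branch is the case where    *)
(* (k, j, i) is a cyclic rotation of a decreasing triple; x_321 is a_4 when   *)
(* n = 3.                                                                     *)
Definition x3 (k j i : 'I_n) : C :=
  let y := if (3 < n)%N then xval [set i; j; k]%SET else a ord_max in
  if [|| (i < j < k)%N, (k < i < j)%N | (j < k < i)%N] then y
  else par k * x2 j i + par j * x2 k i + par i * x2 k j
       - par k * par j * par i - y.

Definition x4 (k j i l : 'I_n) : C :=
  2^-1 * (par k * par j * par i * par l
    + par k * x3 j i l + par j * x3 k i l + par i * x3 k j l + par l * x3 k j i
    + x2 k j * x2 i l - x2 k i * x2 j l + x2 k l * x2 j i
    - par k * par j * x2 i l - par k * par l * x2 j i
    - par j * par i * x2 k l - par l * par i * x2 k j).

Definition s3 (p : 'I_3 -> 'I_n) : C :=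
  let i1 := p (inord 0) in let i2 := p (inord 1) in let i3 := p (inord 2) in
  par i1 * x2 i3 i2 + par i2 * x2 i3 i1 + par i3 * x2 i2 i1
  - par i3 * par i2 * par i1 - 2 * x3 i3 i2 i1.

Definition zed (i j : 'I_n) : C :=
  if i == j then 2^-1 * par i ^+ 2 - 2 else x2 i j - 2^-1 * par i * par j.

(* gfuel m [:: i_1; ...; i_k] is g_(i_k, ..., i_1) as soon as k <= m: each    *)
(* recursive call is on a shorter nonempty list.                              *)
Fixpoint gfuel (m : nat) (s : seq 'I_n) : C :=
  match m, s with
  | _.+1, [:: i1] => par i1
  | _.+1, [:: i1; i2] => x2 i2 i1
  | _.+1, [:: i1; i2; i3] => x3 i3 i2 i1
  | m'.+1, i1 :: i2 :: i3 :: t =>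
      let g := gfuel m' in
      2^-1 * (g t * par i3 * par i2 * par i1 + g t * x3 i3 i2 i1
        + (par i1 * g [:: i2, i3 & t] + par i2 * g [:: i1, i3 & t]
           + par i3 * g [:: i1, i2 & t])
        + g (i3 :: t) * x2 i2 i1 - g (i2 :: t) * x2 i3 i1
        + g (i1 :: t) * x2 i3 i2
        - g t * par i3 * x2 i2 i1 - g t * par i1 * x2 i3 i2
        - g (i1 :: t) * par i3 * par i2 - g (i3 :: t) * par i2 * par i1)
  | _, _ => 0
  end.

Definition gpol (s : seq 'I_n) : C := gfuel (size s) s.

Definition increasing (k : nat) (p : 'I_k -> 'I_n) : Prop :=
  {homo p : u v / (u < v)%N}.

Definition type1_eqs : Prop :=
  forall i j : 'I_3 -> 'I_n, increasing i -> increasing j ->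
  s3 i * s3 j + 2 * \det (\matrix_(p < 3, q < 3) zed (i p) (j q)) = 0.

Definition type2_eqs : Prop :=
  forall (i : 'I_n) (p : 'I_4 -> 'I_n), increasing p ->
  \sum_(k < 4) (-1) ^+ k * zed i (p k) * s3 (fun q : 'I_3 => p (lift k q)) = 0.

Definition type3_eqs : Prop :=
  (3 < n)%N -> gpol (enum 'I_n) - a ord_max = 0.

Definition psi (s t u : C) : C := s ^+ 2 + t ^+ 2 + u ^+ 2 - s * t * u - 4.

(* The index i_0 of a chart is None for i_0 = 0 and Some i for i_0 = i.       *)
Definition chart_psi (j k : 'I_n) (i0 : option 'I_n) : C :=
  match i0 with
  | None => psi (x2 k j) (par k) (par j)
  | Some i => psi (x3 k j i) (x2 k j) (par i)
  end.

Definition chart_pol (j k : 'I_n) (i0 : option 'I_n) : C :=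
  (x2 k j ^+ 2 - 4) * chart_psi j k i0.

Section NormalForm.
Variables (j k : 'I_n) (r : C).

Let lp : C := (x2 k j + r) / 2.
Let lm : C := (x2 k j - r) / 2.

Definition u11 (i : 'I_n) : C :=
  if i == j then - ((par k - lp * par j) / r)
  else if i == k then - ((par j - lp * par k) / r)
  else (x3 k j i - lm * par i) / r.

Definition u22 (i : 'I_n) : C :=
  if i == j then (par k - lm * par j) / r
  else if i == k then (par j - lm * par k) / r
  else - ((x3 k j i - lp * par i) / r).

Definition u12_j (i0 : option 'I_n) : C :=
  match i0 with
  | None => - (chart_psi j k None / r ^+ 2)
  | Some o =>
      - ((x2 k o - par k * u11 o + lm * (x2 j o - par j * u22 o)) / r)
  end.

Definition u21_j (i0 : option 'I_n) : C :=
  match i0 with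
  | None => 1
  | Some o =>
      - (r * (x2 k o - par k * u22 o + lp * (x2 j o - par j * u11 o))
         / chart_psi j k (Some o))
  end.

Definition u12 (i0 : option 'I_n) (i : 'I_n) : C :=
  if i == j then u12_j i0
  else if i == k then - lp * u12_j i0
  else match i0 with
  | None => (x2 k i - par k * u22 i + lp * (x2 j i - par j * u11 i)) / r
  | Some o =>
      if i == o then - (chart_psi j k (Some o) / r ^+ 2)
      else - ((lm * x2 i o + r * u11 i * u11 o - x4 k j i o) / r)
  end.

Definition u21 (i0 : option 'I_n) (i : 'I_n) : C :=
  if i == j then u21_j i0
  else if i == k then - lm * u21_j i0
  else match i0 with
  | None =>
      r * (x2 k i - par k * u11 i + lm * (x2 j i - par j * u22 i))
      / chart_psi j k None
  | Some o =>
      if i == o then 1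
      else - (r * (lp * x2 i o - r * u22 i * u22 o - x4 k j i o)
              / chart_psi j k (Some o))
  end.

Definition normal_form (i0 : option 'I_n) : mtuple C n :=
  fun i => \matrix_(p < 2, q < 2)
    if p == 0 then (if q == 0 then u11 i else u12 i0 i)
    else (if q == 0 then u21 i0 i else u22 i).

End NormalForm.
End Coordinates.

Local Open Scope classical_set_scope.

Section Moduli.
Variables (C : numClosedFieldType) (n : nat).
Implicit Types (M : mtuple C n) (a : 'I_n.+1 -> C) (w : set (mtuple C n)).

(* prod_desc M [:: i_1; ...; i_k] is M_(i_k) ... M_(i_1). *)
Definition prod_desc M (s : seq 'I_n) : 'M[C]_2 := \prod_(i <- rev s) M i.

Definition SL2 : set 'M[C]_2 := [set U | \det U = 1].

Definition trace_orbit (t : C) : set 'M[C]_2 := [set U | SL2 U /\ \tr U = t].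

Definition rep_tuples a : set (mtuple C n) :=
  [set M | (forall i, trace_orbit (par a i) (M i)) /\
           trace_orbit (a ord_max) (prod_desc M (enum 'I_n))^-1].

Definition irreducible M : Prop :=
  forall V : {vspace 'cV[C]_2},
    (forall i v, v \in V -> M i *m v \in V) -> V = 0%VS \/ V = fullv.

(* A conjugacy class is represented by the set of its members. *)
Definition conj_class M : set (mtuple C n) :=
  [set N | exists2 P, SL2 P & forall i, N i = P * M i * P^-1].

Definition moduli_irr a : set (set (mtuple C n)) :=
  conj_class @` (rep_tuples a `&` irreducible).

Definition trace_coords M : cpoint C n :=
  fun A => \tr (prod_desc M (enum (val A))).

(* Traces are invariant under conjugation, so the chosen member of the class  *)
(* is irrelevant.                                                             *)
Definition Phi w : cpoint C n := trace_coords (xget (fun=> 1) w).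

Definition alg_set a : set (cpoint C n) :=
  [set x | [/\ type1_eqs a x, type2_eqs a x & type3_eqs a x]].

Definition chart_pairs (j k : 'I_n) : bool :=
  let J := j.+1 in let K := k.+1 in
  if J == 1%N then (2 <= K < n)%N
  else if (J < n)%N then (J < K <= n)%N
  else K == 1%N.

Definition is_chart (j k : 'I_n) (i0 : option 'I_n) : bool :=
  [&& chart_pairs j k, i0 != Some j & i0 != Some k].

Definition chart_S a j k i0 : set (cpoint C n) :=
  [set x | alg_set a x /\ chart_pol a x j k i0 != 0].

Definition chart_M a j k i0 : set (set (mtuple C n)) :=
  [set w | moduli_irr a w /\ chart_pol a (Phi w) j k i0 != 0].

Definition big_open_S a : set (cpoint C n) :=
  [set x | exists j k i0, is_chart j k i0 /\ chart_S a j k i0 x].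

Definition big_open_M a : set (set (mtuple C n)) :=
  [set w | exists j k i0, is_chart j k i0 /\ chart_M a j k i0 w].

(* The class does not depend on the square root, so the one given by sqrtC    *)
(* is used.                                                                   *)
Definition phi_chart a j k i0 (x : cpoint C n) : set (mtuple C n) :=
  conj_class (normal_form a x j k (sqrtC (x2 x k j ^+ 2 - 4)) i0).

(* I_(p,q) for p + q = 2. *)
Definition Ipq (p q : nat) : 'M[C]_2 :=
  diag_mx (\row_(i < 2) if (i < p)%N then 1 else -1).

Definition SU (p q : nat) : set 'M[C]_2 :=
  [set U | SL2 U /\ (map_mx Num.conj U)^T *m Ipq p q *m U = Ipq p q].

Inductive generated M : 'M[C]_2 -> Prop :=
| generated1 : generated M 1
| generatedM i U : generated M U -> generated M (M i * U)
| generatedV i U : generated M U -> generated M ((M i)^-1 * U).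

Definition unitary_sig (p q : nat) w : Prop :=
  exists2 M, w M & generated M `<=` SU p q.

Definition unitary w : Prop :=
  exists p q, (p + q = 2)%N /\ unitary_sig p q w.

End Moduli.

(* Main.v *)
(* Let J be the matrix with J M = M^-T J for det M = 1.  A matrix M preserves a
   Hermitian form H exactly when H^-T J intertwines M and its complex conjugate.
   - Unitary implies real: the class of a unitary monodromy equals its complex
     conjugate.  Conjugating the normal form of x gives a normal form of the
     conjugate point, for one of the two square roots; replacing r by -r amounts
     to a conjugation by an antidiagonal matrix.  Hence x and its conjugate have
     the same image under phi, and phi is injective.
   - Real implies unitary: if x is real, the conjugate of r is r or -r, so the
     normal form is intertwined with its conjugate by 1 or by the antidiagonal
     matrix; the resulting invariant form is i J, of signature (1,1), or
     diag(1, psi / r^2) up to a scalar.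
   - The signature is unique because, by Schur's lemma, the invariant Hermitian
     form of an irreducible tuple is unique up to a real factor. *)

Require Import Defs.
From mathcomp Require Import all_boot all_order all_algebra.
From mathcomp Require Import boolp classical_sets functions reals.
From mathcomp Require Import ring.

Import Order.TTheory GRing.Theory Num.Theory.
Local Open Scope ring_scope.
Local Open Scope classical_set_scope.

Section Mx2.
Set Implicit Arguments.
Unset Strict Implicit.
Variable C : numClosedFieldType.
Implicit Types (H K M N P Q S U : 'M[C]_2) (c r t : C).

Lemma ord2P (i : 'I_2) : i = 0 \/ i = 1.
Proof. by case: i => [[|[|m]] hm] //; [left|right]; apply: val_inj. Qed.

Lemma eq_mx2 M N : M 0 0 = N 0 0 -> M 0 1 = N 0 1 ->
  M 1 0 = N 1 0 -> M 1 1 = N 1 1 -> M = N.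
Proof.
move=> h00 h01 h10 h11; apply/matrixP => i j.
by have [->|->] := ord2P i; have [->|->] := ord2P j.
Qed.

Lemma mulmx2E M N i j : (M * N) i j = M i 0 * N 0 j + M i 1 * N 1 j.
Proof.
rewrite -mulmxE mxE !big_ord_recl big_ord0 addr0.
by congr (_ + M i _ * N _ j); apply: val_inj.
Qed.

Lemma det_mx22 M : \det M = M 0 0 * M 1 1 - M 0 1 * M 1 0.
Proof.
rewrite (expand_det_row _ 0) !big_ord_recl big_ord0 /cofactor !det_mx11 !mxE.
rewrite /= expr0 expr1 mul1r addr0 mulN1r mulrN.
by congr (_ * M _ _ - M _ _ * M _ _); apply: val_inj.
Qed.

Definition mx2 (c00 c01 c10 c11 : C) : 'M[C]_2 := \matrix_(p < 2, q < 2)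
  if p == 0 then (if q == 0 then c00 else c01)
  else (if q == 0 then c10 else c11).

Definition adj M : 'M[C]_2 := (map_mx Num.conj M)^T.

Lemma adjM M N : adj (M * N) = adj N * adj M.
Proof. by rewrite /adj -!mulmxE map_mxM trmx_mul. Qed.

Lemma adjZ c M : adj (c *: M) = c^* *: adj M.
Proof. by rewrite /adj map_mxZ linearZ. Qed.

Lemma adjK : involutive adj.
Proof. by move=> M; apply/matrixP => i j; rewrite !mxE conjCK. Qed.

Lemma det_adj M : \det (adj M) = (\det M)^*.
Proof. by rewrite /adj det_tr det_map_mx. Qed.

Lemma unit_mx2E M : (M \is a GRing.unit) = (\det M != 0).
Proof. by rewrite -unitfE -unitmxE. Qed.

Lemma adj_unit M : (adj M \is a GRing.unit) = (M \is a GRing.unit).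
Proof. by rewrite !unit_mx2E det_adj fmorph_eq0. Qed.

Definition symp : 'M[C]_2 := mx2 0 1 (-1) 0.

Lemma sympE M : M^T * symp * M = \det M *: symp.
Proof.
by apply: eq_mx2; rewrite !mulmx2E !mxE det_mx22 /=; ring.
Qed.

Lemma symp_unit : symp \is a GRing.unit.
Proof. by rewrite unit_mx2E det_mx22 !mxE /= mulrN1 opprK mul0r add0r oner_neq0. Qed.

Definition preserves H M : Prop := adj M * H * M = H.

Lemma preservesM H M N : preserves H M -> preserves H N -> preserves H (M * N).
Proof.
by rewrite /preserves adjM => hM hN; rewrite -{2}hN -{2}hM !mulrA.
Qed.

Lemma preservesV H M : M \is a GRing.unit -> preserves H M ->
  preserves H M^-1.
Proof.
move=> uM hM; rewrite /preserves -{1}hM !mulrA -adjM.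
rewrite mulrV // -!mulrA mulrV // mulr1.
suff -> : adj 1 = 1 by rewrite mul1r.
by rewrite /adj map_mx1 trmx1.
Qed.

Lemma preserves_conj H P M N : P \is a GRing.unit -> N * P = P * M ->
  preserves H N <-> preserves (adj P * H * P) M.
Proof.
move=> uP hN; rewrite /preserves.
have -> : adj M * (adj P * H * P) * M = adj P * (adj N * H * N) * P.
  by rewrite !mulrA -adjM -hN adjM -!mulrA hN.
split=> [->//|]; rewrite -!mulrA => /(mulrI _) h; apply/(mulIr uP).
by rewrite -!mulrA; apply: h; rewrite adj_unit.
Qed.

(* [symp] intertwines [M] and its inverse transpose when [det M = 1], so an
   intertwiner [Q] of [M] and its conjugate makes [Q^-T symp] invariant. *)
Lemma preserves_of_conj_intertwiner H M Q c : \det M = 1 ->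
  Q \is a GRing.unit -> map_mx Num.conj M * Q = Q * M ->
  Q^T * H = c *: symp -> preserves H M.
Proof.
move=> dM uQ hQ hH; have uQT : Q^T \is a GRing.unit.
  by rewrite unit_mx2E det_tr -unit_mx2E.
apply: (mulrI uQT); rewrite /adj !mulrA.
have -> : Q^T * (map_mx Num.conj M)^T = M^T * Q^T.
  by rewrite -!mulmxE -!trmx_mul !mulmxE hQ.
by rewrite -(mulrA _ Q^T) hH -scalerAr -scalerAl sympE dM scale1r.
Qed.

Lemma conj_intertwiner H M : \det M = 1 -> H \is a GRing.unit ->
  preserves H M ->
  map_mx Num.conj M * (H^T)^-1 * symp = (H^T)^-1 * symp * M.
Proof.
move=> dM uH hM; have uHT : H^T \is a GRing.unit.
  by rewrite unit_mx2E det_tr -unit_mx2E.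
have uM : M^T \is a GRing.unit by rewrite unit_mx2E det_tr dM oner_neq0.
have hT : M^T * H^T * map_mx Num.conj M = H^T.
  by rewrite -[in RHS]hM /adj -!mulmxE !trmx_mul trmxK mulmxA.
have -> : map_mx Num.conj M = (H^T)^-1 * (M^T)^-1 * H^T.
  by rewrite -[X in _ * X]hT !mulrA mulrVK // mulVr // mul1r.
have := sympE M; rewrite dM scale1r => hs.
by rewrite mulrK // -{1}hs !mulrA mulrVK.
Qed.

Lemma Ipq_conj p q : map_mx Num.conj (Ipq C p q) = Ipq C p q.
Proof.
by apply/matrixP => i j; rewrite !mxE rmorphMn /=; case: ifP; rewrite ?rmorphN rmorph1.
Qed.

Lemma Ipq_tr p q : (Ipq C p q)^T = Ipq C p q.
Proof. by rewrite tr_diag_mx. Qed.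

Lemma Ipq_adj p q : adj (Ipq C p q) = Ipq C p q.
Proof. by rewrite /adj Ipq_conj Ipq_tr. Qed.

Lemma det_Ipq p q : \det (Ipq C p q) =
  (if (0 < p)%N then 1 else -1) * (if (1 < p)%N then 1 else -1).
Proof.
by rewrite det_diag !big_ord_recl big_ord0 mulr1 !mxE.
Qed.

Lemma Ipq_unit p q : Ipq C p q \is a GRing.unit.
Proof.
rewrite unit_mx2E det_Ipq.
by do 2 case: ifP => _; rewrite ?mulrN1 ?mulr1 ?opprK ?oppr_eq0 oner_neq0.
Qed.

End Mx2.

Section Classes.
Set Implicit Arguments.
Unset Strict Implicit.
Variables (C : numClosedFieldType) (n : nat).
Implicit Types (M N : mtuple C n) (H K P Q S : 'M[C]_2) (w : set (mtuple C n)).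

Lemma SL2_unit P : SL2 P -> P \is a GRing.unit.
Proof. by rewrite unit_mx2E => ->; rewrite oner_neq0. Qed.

Lemma conj_class_refl M : conj_class M M.
Proof. by exists 1; [exact: det1 | move=> i; rewrite mul1r invr1 mulr1]. Qed.

(* [P] may be rescaled to have determinant 1. *)
Lemma conj_class_unit M N P : P \is a GRing.unit ->
  (forall i, N i * P = P * M i) -> conj_class M N.
Proof.
move=> uP hP; have dP : \det P != 0 by rewrite -unit_mx2E.
have s2 : sqrtC (\det P)^-1 ^+ 2 = (\det P)^-1 by exact: sqrtCK.
have s0 : sqrtC (\det P)^-1 != 0 by rewrite sqrtC_eq0 invr_eq0.
have uQ : SL2 (sqrtC (\det P)^-1 *: P) by rewrite /SL2/= detZ s2 mulVf.
exists (sqrtC (\det P)^-1 *: P) => // i.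
apply: (mulIr (SL2_unit uQ)); rewrite mulrVK ?SL2_unit //.
by rewrite -scalerAr -scalerAl hP.
Qed.

Lemma conj_class_eqmem M N L : conj_class M L -> conj_class N L ->
  conj_class M `<=` conj_class N.
Proof.
move=> [A sA hA] [B sB hB] T [D sD hD].
have uA := SL2_unit sA; have uB := SL2_unit sB; have uD := SL2_unit sD.
apply: (@conj_class_unit _ _ (D * A^-1 * B)).
  by rewrite !unitrMl // ?unitrV.
move=> i; have hLB : L i * B = B * N i by rewrite hB mulrVK.
have hMA : M i * A^-1 = A^-1 * L i by rewrite hA !mulrA mulVr // mul1r.
by rewrite hD !mulrA mulrVK // -(mulrA D) hMA -!mulrA hLB.
Qed.

Lemma conj_class_eq M N L : conj_class M L -> conj_class N L ->
  conj_class M = conj_class N.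
Proof. by move=> hM hN; apply/seteqP; split; apply: conj_class_eqmem; eassumption. Qed.

Lemma SUE p q (U : 'M[C]_2) : SU p q U <-> \det U = 1 /\ preserves (Ipq C p q) U.
Proof. by []. Qed.

Lemma generated_SU p q M :
  generated M `<=` SU p q <-> (forall i, SU p q (M i)).
Proof.
split=> [h i|h U]; first by rewrite -[M i]mulr1; apply/h/generatedM/generated1.
elim=> [|i V _|i V _].
- by apply/SUE; split; rewrite ?det1 // /preserves /adj map_mx1 trmx1 mul1r mulr1.
- move=> /SUE[dV hV]; have /SUE[di hi] := h i; apply/SUE.
  by rewrite -mulmxE det_mulmx di dV mulr1; split=> //; apply: preservesM.
- move=> /SUE[dV hV]; have /SUE[di hi] := h i; apply/SUE.
  rewrite -mulmxE det_mulmx -[(M i)^-1]/(invmx (M i)) det_inv di invr1 dV mulr1.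
  split=> //; apply: preservesM => //; apply: preservesV => //.
  exact: SL2_unit.
Qed.

Lemma irreducible_commutant M K : irreducible M ->
  (forall i, K * M i = M i * K) -> exists c, K = c%:M.
Proof.
move=> irr comK; have [c /eigenvalueP[v vK v0]] := eigenvalue_closed K^T isT.
exists c; pose V := lker (linfun (mulmx (K - c%:M) : 'cV_2 -> 'cV_2)).
have memV u : (u \in V) = (K *m u == c *: u).
  by rewrite memv_ker lfunE /= mulmxBl mul_scalar_mx subr_eq0.
have VM i u : u \in V -> M i *m u \in V.
  rewrite !memV => /eqP hu; rewrite mulmxA mulmxE comK -mulmxE -mulmxA hu.
  by rewrite scalemxAr.
have [V0|VT] := irr V VM.
  have : v^T \in V.
    by rewrite memV -[K]trmxK -trmx_mul vK linearZ.
  by rewrite V0 memv0 -trmx0 (inj_eq trmx_inj) (negPf v0).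
apply/eqP; rewrite -subr_eq0; apply/eqP/matrixP => i j.
have : delta_mx j 0 \in V by rewrite VT memvf.
rewrite memv_ker lfunE /= => /eqP/matrixP/(_ i 0).
by rewrite -colE !mxE.
Qed.

(* By Schur's lemma two invariant Hermitian forms are proportional, with a
   real ratio, so their determinants have the same sign. *)
Lemma irreducible_forms_det M H K : irreducible M ->
  adj H = H -> adj K = K -> H \is a GRing.unit -> K \is a GRing.unit ->
  (forall i, \det (M i) = 1) ->
  (forall i, preserves H (M i)) -> (forall i, preserves K (M i)) ->
  0 < \det H * \det K.
Proof.
move=> irr aH aK uH uK dM hH hK.
have uM i : adj (M i) \is a GRing.unit.
  by rewrite adj_unit unit_mx2E dM oner_neq0.
have [i|c hc] := irreducible_commutant irr (K := H^-1 * K).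
  have hK' : adj (M i) * (K * M i) = K by rewrite mulrA hK.
  have hH' : adj (M i) * (H * M i) = H by rewrite mulrA hH.
  apply: (mulrI uH); rewrite !mulrA mulrV // mul1r; apply: (mulrI (uM i)).
  rewrite hK' -!mulrA.
  by rewrite [H * _]mulrA mulrA hH' !mulrA mulrV ?mul1r.
have {}hc : K = c *: H.
  by rewrite -[K](mulVKr uH) hc -mulmxE mul_mx_scalar.
have c0 : c != 0.
  by apply: contraTneq uK => c0; rewrite hc c0 scale0r unitr0.
have c_real : c^* = c.
  have := aK; rewrite hc adjZ aH => /eqP; rewrite -subr_eq0 -scalerBl scaler_eq0.
  case/orP => [|/eqP H0]; first by rewrite subr_eq0 => /eqP.
  by move: uH; rewrite H0 unitr0.
have dH : (\det H)^* = \det H by rewrite -det_adj aH.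
have dH0 : \det H != 0 by rewrite -unit_mx2E.
have -> : \det H * \det K = (c * \det H) * (c * \det H)^*.
  by rewrite hc detZ rmorphM /= c_real dH; ring.
by rewrite mul_conjC_gt0 mulf_neq0.
Qed.

Lemma unitary_sig_det (a : 'I_n.+1 -> C) w p q p' q' : moduli_irr a w ->
  unitary_sig p q w -> unitary_sig p' q' w ->
  0 < \det (Ipq C p q) * \det (Ipq C p' q').
Proof.
move=> [M [[repM _] irrM] <-].
have dM i : \det (M i) = 1 by have [] := repM i.
have form s t : unitary_sig s t (conj_class M) -> exists2 P, SL2 P &
    forall i, preserves (adj P * Ipq C s t * P) (M i).
  move=> [N [P sP hP] /generated_SU hN]; exists P => // i.
  have /SUE[_ h] := hN i; move: h; apply preserves_conj; first exact: SL2_unit.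
  by rewrite hP mulrVK // SL2_unit.
move=> /form[P sP hP] /form[Q sQ hQ].
have herm s t A : adj (adj A * Ipq C s t * A) = adj A * Ipq C s t * A.
  by rewrite !adjM adjK Ipq_adj mulrA.
have unit_form s t A : SL2 A -> adj A * Ipq C s t * A \is a GRing.unit.
  by move=> sA; rewrite !unitrMl ?adj_unit ?Ipq_unit ?SL2_unit.
have det_form s t A : SL2 A -> \det (adj A * Ipq C s t * A) = \det (Ipq C s t).
  by move=> sA; rewrite -!mulmxE !det_mulmx det_adj sA rmorph1 mul1r mulr1.
have := @irreducible_forms_det M _ _ irrM (herm p q P) (herm p' q' Q)
  (unit_form _ _ _ sP) (unit_form _ _ _ sQ) dM hP hQ.
by rewrite !det_form.
Qed.

Lemma unitary_sig_of_intertwiner M p q Q S c : (forall i, \det (M i) = 1) ->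
  (forall i, map_mx Num.conj (M i) * Q = Q * M i) ->
  Q \is a GRing.unit -> S \is a GRing.unit ->
  Q^T * (adj S * Ipq C p q * S) = c *: symp C ->
  unitary_sig p q (conj_class M).
Proof.
move=> dM hQ uQ uS hS; exists (fun i => S * M i * S^-1).
  by apply: (conj_class_unit uS) => i; rewrite mulrVK.
apply/generated_SU => i; apply/SUE; split.
  rewrite -!mulmxE !det_mulmx -[S^-1]/(invmx S) det_inv dM mulr1 mulfV //.
  by rewrite -unit_mx2E.
have hi : S * M i * S^-1 * S = S * M i by rewrite mulrVK.
apply/(preserves_conj _ uS hi).
exact: (preserves_of_conj_intertwiner (dM i) uQ (hQ i) hS).
Qed.

Definition conj_tuple M : mtuple C n := fun i => map_mx Num.conj (M i).

Lemma unitary_conj_class M : (forall i, \det (M i) = 1) ->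
  unitary (conj_class M) -> conj_class (conj_tuple M) M.
Proof.
move=> dM [p [q [_ [N [P sP hP] /generated_SU hN]]]].
have uP := SL2_unit sP.
have hPc i : preserves (adj P * Ipq C p q * P) (M i).
  have /SUE[_ h] := hN i; move: h; apply preserves_conj => //.
  by rewrite hP mulrVK.
set H := adj P * Ipq C p q * P in hPc.
have uH : H \is a GRing.unit by rewrite !unitrMl ?adj_unit ?Ipq_unit.
have uHT : H^T \is a GRing.unit by rewrite unit_mx2E det_tr -unit_mx2E.
have uQ : (H^T)^-1 * symp C \is a GRing.unit.
  by rewrite unitrMl ?unitrV ?symp_unit.
apply: (@conj_class_unit _ _ ((H^T)^-1 * symp C)^-1); first by rewrite unitrV.
move=> i; have := conj_intertwiner (dM i) uH (hPc i).
rewrite -mulrA => hi.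
have -> : M i = ((H^T)^-1 * symp C)^-1 * (conj_tuple M i * ((H^T)^-1 * symp C)).
  by rewrite hi mulKr.
by rewrite -mulrA mulrK.
Qed.

End Classes.

Section Conjugation.
Set Implicit Arguments.
Unset Strict Implicit.
Variables (C : numClosedFieldType) (n : nat).
Variables (a : 'I_n.+1 -> C).
Hypothesis a_real : forall i, a i \is Num.real.
Implicit Types (x : cpoint C n) (i j k l : 'I_n) (r : C).

Definition conj_point x : cpoint C n := fun A => (x A)^*.

Lemma conj_point_real x : real_point x -> conj_point x = x.
Proof. by move=> x_real; apply: funext => A; exact/CrealP. Qed.

Lemma real_conj_point x : conj_point x = x -> real_point x.
Proof. by move=> xE A; apply/CrealP; rewrite -[in RHS]xE. Qed.

Local Definition conjE := (rmorph_nat, rmorph1, rmorphB, rmorphD, rmorphN, rmorphM, fmorphV, rmorphXn).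

Lemma a_conj (i : 'I_n.+1) : (a i)^* = a i. Proof. exact/CrealP. Qed.

Lemma par_conj i : (par a i)^* = par a i. Proof. exact: a_conj. Qed.

Lemma xval_conj x A : xval (conj_point x) A = (xval x A)^*.
Proof. by rewrite /xval; case: insub => //=; rewrite rmorph0. Qed.

Lemma x2_conj x j i : x2 (conj_point x) j i = (x2 x j i)^*.
Proof. exact: xval_conj. Qed.

Lemma x3_conj x k j i : x3 a (conj_point x) k j i = (x3 a x k j i)^*.
Proof.
rewrite /x3 xval_conj !x2_conj.
by do 2 case: ifP => _; rewrite ?conjE /= ?par_conj ?a_conj.
Qed.

Lemma x4_conj x k j i l : x4 a (conj_point x) k j i l = (x4 a x k j i l)^*.
Proof. by rewrite /x4 !x3_conj !x2_conj !conjE /= !par_conj. Qed.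

Lemma s3_conj x p : s3 a (conj_point x) p = (s3 a x p)^*.
Proof. by rewrite /s3 !x3_conj !x2_conj !conjE /= !par_conj. Qed.

Lemma zed_conj x i j : zed a (conj_point x) i j = (zed a x i j)^*.
Proof. by rewrite /zed x2_conj; case: ifP => _; rewrite !conjE /= !par_conj. Qed.

Lemma gfuel_conj x m s : gfuel a (conj_point x) m s = (gfuel a x m s)^*.
Proof.
elim: m s => [|m IHm] [|i1 [|i2 [|i3 [|i4 t]]]] /=;
  rewrite ?rmorph0 ?par_conj ?x2_conj ?x3_conj //.
by rewrite !IHm !conjE /= !par_conj.
Qed.

Lemma psi_conj (s t u : C) : psi s^* t^* u^* = (psi s t u)^*.
Proof. by rewrite /psi !conjE. Qed.

Lemma chart_psi_conj x j k (i0 : option 'I_n) :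
  chart_psi a (conj_point x) j k i0 = (chart_psi a x j k i0)^*.
Proof.
by case: i0 => [o|] /=; rewrite ?x3_conj !x2_conj -psi_conj !par_conj.
Qed.

Lemma chart_pol_conj x j k (i0 : option 'I_n) :
  chart_pol a (conj_point x) j k i0 = (chart_pol a x j k i0)^*.
Proof. by rewrite /chart_pol chart_psi_conj x2_conj !conjE. Qed.

Lemma alg_set_conj x : alg_set a x -> alg_set a (conj_point x).
Proof.
have eq0_conj (u : C) : u = 0 -> u^* = 0 by move=> ->; rewrite rmorph0.
move=> [t1 t2 t3]; split.
- move=> i j hi hj; rewrite -[RHS](eq0_conj _ (t1 i j hi hj)) !s3_conj !conjE /=.
  rewrite -det_map_mx; congr (_ + 2 * \det _).
  by apply/matrixP => p q; rewrite !mxE zed_conj.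
- move=> i p hp; rewrite -[RHS](eq0_conj _ (t2 i p hp)) rmorph_sum.
  by apply: eq_bigr => q _; rewrite zed_conj s3_conj !conjE.
- by move=> n4; rewrite -[RHS](eq0_conj _ (t3 n4)) /gpol gfuel_conj conjE /= a_conj.
Qed.

Lemma chart_S_conj x j k (i0 : option 'I_n) : chart_S a j k i0 x -> chart_S a j k i0 (conj_point x).
Proof.
by move=> [/alg_set_conj Sx px]; split=> //; rewrite chart_pol_conj fmorph_eq0.
Qed.

Lemma u11_conj x j k r i : u11 a (conj_point x) j k r^* i = (u11 a x j k r i)^*.
Proof.
rewrite /u11 x3_conj x2_conj.
by do 2 (case: ifP => _; first by rewrite !conjE /= !par_conj); rewrite !conjE /= par_conj.
Qed.

Lemma u22_conj x j k r i : u22 a (conj_point x) j k r^* i = (u22 a x j k r i)^*.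
Proof.
rewrite /u22 x3_conj x2_conj.
by do 2 (case: ifP => _; first by rewrite !conjE /= !par_conj); rewrite !conjE /= par_conj.
Qed.

Local Definition nfE := (chart_psi_conj, x4_conj, u11_conj, u22_conj, x2_conj).

Lemma u12_conj x j k r (i0 : option 'I_n) i :
  u12 a (conj_point x) j k r^* i0 i = (u12 a x j k r i0 i)^*.
Proof.
rewrite /u12 /u12_j; case: i0 => [o|]; repeat case: ifP => _;
  by rewrite !nfE !conjE /= ?par_conj.
Qed.

Lemma u21_conj x j k r (i0 : option 'I_n) i :
  u21 a (conj_point x) j k r^* i0 i = (u21 a x j k r i0 i)^*.
Proof.
rewrite /u21 /u21_j; case: i0 => [o|]; repeat case: ifP => _;
  by rewrite ?nfE ?conjE /= ?par_conj ?rmorph1.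
Qed.

Lemma normal_form_conj x j k r (i0 : option 'I_n) :
  normal_form a (conj_point x) j k r^* i0 = conj_tuple (normal_form a x j k r i0).
Proof.
apply: funext => i; apply/matrixP => p q; rewrite !mxE.
by do 2 case: ifP => _; rewrite ?u11_conj ?u22_conj ?u12_conj ?u21_conj.
Qed.

Lemma u11_opp x j k r i : u11 a x j k (- r) i = u22 a x j k r i.
Proof. by rewrite /u11 /u22 opprK invrN !mulrN !opprK; do 2 (case: ifP => _ //). Qed.

Lemma u22_opp x j k r i : u22 a x j k (- r) i = u11 a x j k r i.
Proof. by rewrite -{2}(opprK r) u11_opp. Qed.

Lemma u12_opp x j k r (i0 : option 'I_n) i : r != 0 -> chart_psi a x j k i0 != 0 ->
  u12 a x j k (- r) i0 i = - (chart_psi a x j k i0 / r ^+ 2) * u21 a x j k r i0 i.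
Proof.
move=> r0; rewrite /u12 /u21 /u12_j /u21_j.
case: i0 => [o|]; set P := chart_psi _ _ _ _ _ => P0;
  rewrite !(u11_opp, u22_opp) ?opprK; repeat case: ifP => _; field; rewrite ?r0 ?P0 //.
Qed.

Definition root_swap x j k r (i0 : option 'I_n) : 'M[C]_2 :=
  mx2 0 (- (chart_psi a x j k i0 / r ^+ 2)) 1 0.

Lemma root_swap_unit x j k r (i0 : option 'I_n) : r != 0 -> chart_psi a x j k i0 != 0 ->
  root_swap x j k r i0 \is a GRing.unit.
Proof.
move=> r0 P0; rewrite unit_mx2E det_mx22 !mxE /= mulr1 mul0r sub0r opprK.
by rewrite mulf_neq0 // invr_neq0 // expf_neq0.
Qed.

Lemma normal_form_opp x j k r (i0 : option 'I_n) i : r != 0 -> chart_psi a x j k i0 != 0 ->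
  normal_form a x j k (- r) i0 i * root_swap x j k r i0 =
  root_swap x j k r i0 * normal_form a x j k r i0 i.
Proof.
move=> r0 P0; have h := u12_opp i r0 P0.
have := @u12_opp x j k (- r) i0 i; rewrite oppr_eq0 sqrrN opprK => /(_ r0 P0) h'.
apply: eq_mx2; rewrite !mulmx2E !mxE /= ?(mul0r, mulr0, add0r, addr0, mul1r, mulr1).
- exact: h.
- by rewrite u11_opp mulrC.
- exact: u22_opp.
- by rewrite h' mulrC.
Qed.

Lemma normal_form_root x j k r r' (i0 : option 'I_n) : r' ^+ 2 = r ^+ 2 -> r != 0 ->
  chart_psi a x j k i0 != 0 ->
  conj_class (normal_form a x j k r i0) (normal_form a x j k r' i0).
Proof.
move=> /eqP; rewrite eqf_sqr => /orP[/eqP-> _ _|/eqP-> r0 P0].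
  exact: conj_class_refl.
apply: (conj_class_unit (root_swap_unit r0 P0)) => i.
exact: normal_form_opp.
Qed.

End Conjugation.

Section Signature.
Set Implicit Arguments.
Unset Strict Implicit.
Variables (C : numClosedFieldType) (n : nat).
Variables (a : 'I_n.+1 -> C).
Hypothesis a_real : forall i, a i \is Num.real.
Implicit Types (x : cpoint C n) (j k : 'I_n).

Lemma moduli_irr_det (M : mtuple C n) : moduli_irr a (conj_class M) ->
  forall i, \det (M i) = 1.
Proof.
move=> [N [[hN _] _] eqNM] i; have := conj_class_refl M.
rewrite -eqNM => -[P /SL2_unit uP ->]; have [+ _] := hN i; rewrite /SL2/= => dN.
rewrite -!mulmxE !det_mulmx -[P^-1]/(invmx P) det_inv dN mulr1 mulfV //.
by rewrite -unit_mx2E.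
Qed.

Lemma chart_pol_neq0 x j k (i0 : option 'I_n) : chart_pol a x j k i0 != 0 ->
  sqrtC (x2 x k j ^+ 2 - 4) != 0 /\ chart_psi a x j k i0 != 0.
Proof. by rewrite /chart_pol mulf_eq0 negb_or sqrtC_eq0 => /andP. Qed.

Lemma phi_chart_conj x j k (i0 : option 'I_n) : chart_pol a x j k i0 != 0 ->
  moduli_irr a (phi_chart a j k i0 x) -> unitary (phi_chart a j k i0 x) ->
  phi_chart a j k i0 (conj_point x) = phi_chart a j k i0 x.
Proof.
move=> px /moduli_irr_det dM /(unitary_conj_class dM) hM.
have px' : chart_pol a (conj_point x) j k i0 != 0.
  by rewrite chart_pol_conj // fmorph_eq0.
have [r0 P0] := chart_pol_neq0 px; have [r0' P0'] := chart_pol_neq0 px'.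
rewrite -normal_form_conj // in hM.
apply: (conj_class_eq (L := normal_form a (conj_point x) j k
  (sqrtC (x2 x k j ^+ 2 - 4))^* i0)).
  apply: normal_form_root => //.
  by rewrite -rmorphXn /= !sqrtCK x2_conj rmorphB rmorphXn rmorph_nat.
by have := conj_class_eq hM (conj_class_refl _) => <-; apply: conj_class_refl.
Qed.

Lemma unitary_sig11_real (M : mtuple C n) : (forall i, \det (M i) = 1) ->
  conj_tuple M = M -> unitary_sig 1 1 (conj_class M).
Proof.
move=> dM rM; have i0 : 'i != 0 :> C by exact: neq0Ci.
apply: (@unitary_sig_of_intertwiner _ _ _ _ _ 1 (mx2 1 'i 1 (- 'i)) (2 * 'i)) => //.
- by move=> i; rewrite -[map_mx _ _]/(conj_tuple M i) rM mulr1 mul1r.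
- exact: unitr1.
- rewrite unit_mx2E det_mx22 !mxE /= mul1r mulr1 -opprD oppr_eq0 -mulr2n.
  by rewrite mulrn_eq0.
rewrite trmx1 mul1r; apply: eq_mx2;
  rewrite !(mulmx2E, mxE) /= ?rmorphN ?rmorph1 /= ?conjCi; ring.
Qed.

Lemma sqrtC_mul_conj (t : C) : 0 <= t -> (sqrtC t)^* * sqrtC t = t.
Proof.
by move=> t0; rewrite geC0_conj ?sqrtC_ge0 // -expr2 sqrtCK.
Qed.

Lemma unitary_sig_swap (M : mtuple C n) (t : C) : t != 0 ->
  t \is Num.real -> (forall i, \det (M i) = 1) ->
  (forall i, map_mx Num.conj (M i) * mx2 0 (- t) 1 0 =
             mx2 0 (- t) 1 0 * M i) ->
  if 0 < t then unitary_sig 2 0 (conj_class M)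
  else unitary_sig 1 1 (conj_class M).
Proof.
move=> t0 rt dM hM.
have uQ : mx2 0 (- t) 1 0 \is a GRing.unit.
  by rewrite unit_mx2E det_mx22 !mxE /= mul0r mulr1 sub0r opprK.
case: ifPn => [t_gt0|].
  apply: (unitary_sig_of_intertwiner (S := mx2 1 0 0 (sqrtC t)) (c := t) dM hM) => //.
    by rewrite unit_mx2E det_mx22 !mxE /= mul0r mul1r subr0 sqrtC_eq0.
  have h := sqrtC_mul_conj (ltW t_gt0).
  apply: eq_mx2; rewrite !(mulmx2E, mxE) /= ?rmorph0 ?rmorph1; ring: h.
rewrite real_ltNge ?real0 // negbK le_eqVlt (negPf t0) /= => t_lt0.
apply: (unitary_sig_of_intertwiner (S := mx2 1 0 0 (sqrtC (- t))) (c := t) dM hM) => //.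
  by rewrite unit_mx2E det_mx22 !mxE /= mul0r mul1r subr0 sqrtC_eq0 oppr_eq0.
have h : (sqrtC (- t))^* * sqrtC (- t) = - t.
  by apply: sqrtC_mul_conj; rewrite oppr_ge0 ltW.
apply: eq_mx2; rewrite !(mulmx2E, mxE) /= ?rmorph0 ?rmorph1; ring: h.
Qed.

Lemma sqrtC_neg_conj (z : C) : z < 0 -> (sqrtC z)^* = - sqrtC z.
Proof.
move=> z0; have zr : z^* = z by apply/CrealP; rewrite ltr0_real.
have : ((sqrtC z)^*) ^+ 2 == (sqrtC z) ^+ 2 by rewrite -rmorphXn /= sqrtCK zr.
rewrite eqf_sqr => /orP[/eqP h|/eqP //].
have := mul_conjC_ge0 (sqrtC z); rewrite h -expr2 sqrtCK => /le_lt_trans/(_ z0).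
by rewrite ltxx.
Qed.

Lemma sqrtC_pos_conj (z : C) : 0 < z -> (sqrtC z)^* = sqrtC z.
Proof. by move=> z0; rewrite geC0_conj // sqrtC_ge0 ltW. Qed.

Section Chart.
Variables (x : cpoint C n) (j k : 'I_n) (i0 : option 'I_n).
Hypotheses (x_real : real_point x) (px : chart_pol a x j k i0 != 0).
Hypothesis Mx : moduli_irr a (phi_chart a j k i0 x).
Let z := x2 x k j ^+ 2 - 4.
Let P := chart_psi a x j k i0.

Lemma chart_unitary_sig_pos : 0 < z -> unitary_sig 1 1 (phi_chart a j k i0 x).
Proof.
move=> z0; apply: unitary_sig11_real; first exact: moduli_irr_det.
by rewrite -normal_form_conj // (conj_point_real x_real) sqrtC_pos_conj.
Qed.

Lemma chart_unitary_sig_neg : z < 0 ->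
  if 0 < P then unitary_sig 1 1 (phi_chart a j k i0 x)
  else unitary_sig 2 0 (phi_chart a j k i0 x).
Proof.
move=> z0; have [r0 P0] := chart_pol_neq0 px.
have P_real : P \is Num.real.
  by apply/CrealP; rewrite -chart_psi_conj // conj_point_real.
have t0 : P / z != 0 by rewrite mulf_neq0 // invr_neq0 // ltr0_neq0.
have t_real : P / z \is Num.real by rewrite realM // realV ltr0_real.
have := unitary_sig_swap t0 t_real (moduli_irr_det Mx).
have -> : (0 < P / z) = ~~ (0 < P).
  by rewrite nmulr_lgt0 ?invr_lt0 // -real_leNgt ?real0 // le_eqVlt (negPf P0).
rewrite if_neg; apply => i.
have <- : sqrtC z ^+ 2 = z by exact: sqrtCK.
rewrite -[map_mx _ _]/(conj_tuple (normal_form a x j k (sqrtC z) i0) i).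
rewrite -normal_form_conj // (conj_point_real x_real) sqrtC_neg_conj //.
exact: normal_form_opp.
Qed.

Lemma chart_signature :
  (unitary_sig 1 1 (phi_chart a j k i0 x) <-> 0 < z \/ (z < 0 /\ 0 < P)) /\
  (unitary_sig 2 0 (phi_chart a j k i0 x) \/
   unitary_sig 0 2 (phi_chart a j k i0 x) <-> z < 0 /\ P < 0).
Proof.
have [z0 P0] : z != 0 /\ P != 0 by move: px; rewrite mulf_eq0 negb_or => /andP.
have P_real : P \is Num.real.
  by apply/CrealP; rewrite -chart_psi_conj // conj_point_real.
have z_real : z \is Num.real.
  by apply/CrealP; rewrite rmorphB rmorphXn rmorph_nat /= -x2_conj conj_point_real.
have excl p q : \det (Ipq C p q) = 1 -> unitary_sig 1 1 (phi_chart a j k i0 x) ->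
    ~ unitary_sig p q (phi_chart a j k i0 x).
  move=> dpq h /(unitary_sig_det Mx h); rewrite dpq det_Ipq /= mul1r mulr1.
  by rewrite oppr_gt0 ltr10.
have d20 : \det (Ipq C 2 0) = 1 by rewrite det_Ipq mulr1.
have d02 : \det (Ipq C 0 2) = 1 by rewrite det_Ipq /= mulrN1 opprK.
have nexcl : unitary_sig 1 1 (phi_chart a j k i0 x) ->
    ~ (unitary_sig 2 0 (phi_chart a j k i0 x) \/
       unitary_sig 0 2 (phi_chart a j k i0 x)).
  by move=> h [] => h'; [exact: excl d20 h h' | exact: excl d02 h h'].
have [z_gt0|z_lt0|/eqP] := real_ltgtP (real0 C) z_real; last first.
- by rewrite eq_sym (negPf z0).
- have := chart_unitary_sig_neg z_lt0.
  have [P_gt0|P_lt0|/eqP] := real_ltgtP (real0 C) P_real; last first.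
  + by rewrite eq_sym (negPf P0).
  + move=> h; split; split=> //; [|by case=> // -[]| by left].
    by move=> /nexcl[]; left.
  + move=> h; split; split=> //; [by right | by move=> /(nexcl h) | by case].
- have h := chart_unitary_sig_pos z_gt0.
  by split; split=> //; [left | move=> /(nexcl h) | case].
Qed.

End Chart.
End Signature.

Theorem theorem5p1 (R : realType) (n : nat) (hn : (3 <= n)%N)
  (a : 'I_n.+1 -> R[i]) (ha : forall i, a i \is Num.real)
  (phi : cpoint R[i] n -> set (mtuple R[i] n))
  (phi_bij : set_bij (big_open_S a) (big_open_M a) phi)
  (phi_charts : forall j k i0, is_chart j k i0 ->
     forall x, chart_S a j k i0 x -> phi x = phi_chart a j k i0 x)
  (x : cpoint R[i] n) (hx : big_open_S a x) :
  (unitary (phi x) <-> real_point x) /\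
  (real_point x ->
    (forall j k : 'I_n, is_chart j k None -> chart_S a j k None x ->
       (unitary_sig 1 1 (phi x) <->
          0 < x2 x k j ^+ 2 - 4 \/
          (x2 x k j ^+ 2 - 4 < 0 /\
           0 < psi (x2 x k j) (par a k) (par a j))) /\
       (unitary_sig 2 0 (phi x) \/ unitary_sig 0 2 (phi x) <->
          x2 x k j ^+ 2 - 4 < 0 /\
          psi (x2 x k j) (par a k) (par a j) < 0)) /\
    (forall j k i0 : 'I_n, is_chart j k (Some i0) ->
       chart_S a j k (Some i0) x ->
       (unitary_sig 1 1 (phi x) <->
          0 < x2 x k j ^+ 2 - 4 \/
          (x2 x k j ^+ 2 - 4 < 0 /\
           0 < psi (x3 a x k j i0) (x2 x k j) (par a i0))) /\
       (unitary_sig 2 0 (phi x) \/ unitary_sig 0 2 (phi x) <->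
          x2 x k j ^+ 2 - 4 < 0 /\
          psi (x3 a x k j i0) (x2 x k j) (par a i0) < 0)) /\
    (forall (j k : 'I_n) (i0 : option 'I_n) (j' k' : 'I_n) (i0' : option 'I_n),
       is_chart j k i0 -> chart_S a j k i0 x ->
       is_chart j' k' i0' -> chart_S a j' k' i0' x ->
       (forall p q : nat, (p + q = 2)%N ->
          unitary_sig p q (phi_chart a j k i0 x) <->
          unitary_sig p q (phi_chart a j' k' i0' x)) /\
       (0 < x2 x k j ^+ 2 - 4 \/
          (x2 x k j ^+ 2 - 4 < 0 /\ 0 < chart_psi a x j k i0) <->
        0 < x2 x k' j' ^+ 2 - 4 \/
          (x2 x k' j' ^+ 2 - 4 < 0 /\ 0 < chart_psi a x j' k' i0')) /\
       (x2 x k j ^+ 2 - 4 < 0 /\ chart_psi a x j k i0 < 0 <->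
        x2 x k' j' ^+ 2 - 4 < 0 /\ chart_psi a x j' k' i0' < 0))).

Proof.
have phi_chartE j k i0 y : is_chart j k i0 -> chart_S a j k i0 y ->
    phi y = phi_chart a j k i0 y /\ moduli_irr a (phi_chart a j k i0 y).
  move=> hc hy; have phiE := phi_charts _ _ _ hc _ hy; split=> //.
  have [phi_fun _ _] := phi_bij.
  have : big_open_M a (phi y) by apply: phi_fun; exists j, k, i0.
  by move=> [? [? [? [_ [+ _]]]]]; rewrite phiE.
have signature j k i0 : real_point x -> is_chart j k i0 -> chart_S a j k i0 x ->
    (unitary_sig 1 1 (phi x) <->
       0 < x2 x k j ^+ 2 - 4 \/
       (x2 x k j ^+ 2 - 4 < 0 /\ 0 < chart_psi a x j k i0)) /\
    (unitary_sig 2 0 (phi x) \/ unitary_sig 0 2 (phi x) <->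
       x2 x k j ^+ 2 - 4 < 0 /\ chart_psi a x j k i0 < 0).
  move=> x_real hc Sx; have [-> Mx] := phi_chartE _ _ _ _ hc Sx.
  by apply: chart_signature => //; case: Sx.
have [j [k [i0 [hc Sx]]]] := hx; have [phiE Mx] := phi_chartE _ _ _ _ hc Sx.
split; first split=> [ux|x_real].
- have Sx' := chart_S_conj ha Sx.
  have [phiE' _] := phi_chartE _ _ _ _ hc Sx'.
  have [_ phi_inj _] := phi_bij.
  apply: real_conj_point; apply: phi_inj; rewrite ?inE //.
    by exists j, k, i0.
  rewrite phiE phiE'; apply: phi_chart_conj => //; first by case: Sx.
  by rewrite -phiE.
- have [_ px] := Sx; have [z0 P0] := chart_pol_neq0 px; rewrite phiE.
  have z_real : x2 x k j ^+ 2 - 4 \is Num.real.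
    by apply/CrealP; rewrite rmorphB rmorphXn rmorph_nat /= -x2_conj conj_point_real.
  rewrite sqrtC_eq0 in z0.
  have [z_gt0|z_lt0|/eqP] := real_ltgtP (real0 _) z_real; last first.
  + by rewrite eq_sym (negPf z0).
  + have := chart_unitary_sig_neg ha x_real px Mx z_lt0.
    by case: ifP => _ h; [exists 1%N, 1%N | exists 2%N, 0%N].
  + by exists 1%N, 1%N; split=> //; apply: chart_unitary_sig_pos.
move=> x_real; split; [|split].
- by move=> j' k' hc' Sx'; apply: (signature j' k' None).
- by move=> j' k' o hc' Sx'; apply: (signature j' k' (Some o)).
move=> j1 k1 o1 j2 k2 o2 hc1 Sx1 hc2 Sx2.
have [phi1 _] := phi_chartE _ _ _ _ hc1 Sx1.
have [phi2 _] := phi_chartE _ _ _ _ hc2 Sx2.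
have [s11 s20] := signature _ _ _ x_real hc1 Sx1.
have [t11 t20] := signature _ _ _ x_real hc2 Sx2.
split; first by move=> p q _; rewrite -phi1 -phi2.
by split; [rewrite -s11 -t11 | rewrite -s20 -t20].
Qed.
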